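(* Let $e_t:\mathbb R^n\times\mathcal A\to\mathbb R^k$, $t=1,\dots,T$, be error functions such that for all $t$, each coordinate $i\in\{1,\dots,k\}$ satisfies $$\|\nabla_x e_t(x,a)_i\|\le\beta_e,\qquad \|\nabla_x^2e_t(x,a)_i\|\le\gamma_e,\qquad\text{for all }x\in B(0,R_x),\ a\in\mathcal A.$$ Suppose the random inputs satisfy the following with $\bar\epsilon\le\min\{\frac14,\frac1{2\gamma_e},\frac1{4\beta_e\gamma_e}\}$ and $\underline\sigma>0$: for each $t=0,\dots,T-1$ there is a $\sigma$-algebra $\mathcal G_t$ with $\mathcal F_t'\subseteq\mathcal G_t\subseteq\mathcal F_{t+1}$ and $$\|x_{t+1}-\mathbb E[x_{t+1}\mid\mathcal G_t]\|\le\bar\epsilon,\qquad \mathrm{Cov}(x_{t+1}\mid\mathcal G_t)\succeq\underline\sigma I.$$ If the estimator achieves the zeroth-order regret $\mathbb E\big[\sum_{t=1}^T\|e_t(x_t,\hat a_t)\|^2\big]\le R_0^\ell(T)\le\bar\epsilon^3T$, then $$\mathbb E\left[\sum_{t=1}^T\|\nabla_xe_t(x_t,\hat a_t)\|_F^2\right]\le\frac{2k}{\underline\sigma}(1+\gamma_e+\beta_e\gamma_e)\,\bar\epsilon^3T+2k\gamma_e^2\bar\epsilon^2T.$$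
   Context: Online regression problem: the environment fixes in advance (obliviously) twice differentiable (in $x$) error functions $e_t(x,a)=f_t(x,a_t^* )-f_t(x,a)\in\mathbb R^k$, where $a_t^*\in\mathcal A$ are unknown true parameters and $e_t(x,a)_i$ denotes the $i$-th coordinate. At each time $t$ the estimator outputs $\hat a_t\in\mathcal A$ as a function of the history $x_{0:t-1},\hat a_{0:t-1}$ (possibly randomized); then the environment reveals $x_t\in B(0,R_x)$ (the ball of radius $R_x$ in $\mathbb R^n$), which may depend on the history and may be random. The filtrations are $\mathcal F_t=\sigma(x_{1:t},\hat a_{1:t})$ and $\mathcal F_t'=\sigma(x_{1:t},\hat a_{1:t+1})$, so $\mathcal F_t\subseteq\mathcal F_t'\subseteq\mathcal F_{t+1}$. Expectations are over the randomness of the estimator and of the generation of $x_t$. $\|\cdot\|$ is the Euclidean (or spectral) norm, $\|\cdot\|_F$ the Frobenius norm of the Jacobian; $\beta_e,\gamma_e,\bar\epsilon$ are positive constants. *)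

(* Defs.v *)
From HB Require Import structures.
From mathcomp Require Export all_boot all_order all_algebra.
From mathcomp Require Export all_classical all_reals all_analysis.

Set Implicit Arguments.
Unset Strict Implicit.
Unset Printing Implicit Defensive.

Import Order.TTheory GRing.Theory Num.Theory.
Import numFieldNormedType.Exports.

Local Open Scope classical_set_scope.
Local Open Scope ring_scope.

(* R^n carries the product sigma-algebra generated by the coordinates, which is
   its Borel sigma-algebra; same construction as the library's n.-tuple. *)
Section measurable_rV.
Context {R : realType} (n : nat).

Let coords (i : 'I_n) (v : 'rV[R]_n) : R := v ord0 i.

Let rV_set0 : g_sigma_preimage coords set0.
Proof. exact: sigma_algebra0. Qed.

Let rV_setC A : g_sigma_preimage coords A -> g_sigma_preimage coords (~` A).
Proof. exact: sigma_algebraC. Qed.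

Let rV_bigcup (F : (set 'rV[R]_n)^nat) :
  (forall i, g_sigma_preimage coords (F i)) ->
  g_sigma_preimage coords (\bigcup_i (F i)).
Proof. exact: sigma_algebra_bigcup. Qed.

HB.instance Definition _ := @isMeasurable.Build default_measure_display
  'rV[R]_n (g_sigma_preimage coords) rV_set0 rV_setC rV_bigcup.

End measurable_rV.

(* The library norm `|_| on matrices is the sup norm, hence the norms below. *)
Section euclidean.
Context {R : realType}.

Definition enorm {n : nat} (v : 'rV[R]_n) : R :=
  Num.sqrt (\sum_(i < n) v ord0 i ^+ 2).

Definition cball0 (n : nat) (r : R) : set 'rV[R]_n := [set v | enorm v <= r].

Definition frobenius_norm {m n : nat} (M : 'M[R]_(m, n)) : R :=
  Num.sqrt (\sum_(i < m) \sum_(j < n) M i j ^+ 2).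

Definition spectral_norm {m n : nat} (M : 'M[R]_(m, n)) : R :=
  sup [set enorm (v *m M) | v in @cball0 m 1].

Definition psd {n : nat} (M : 'M[R]_n) : Prop :=
  M^T = M /\ forall v : 'rV[R]_n, 0 <= (v *m M *m v^T) ord0 ord0.

Definition loewner_le {n : nat} (A B : 'M[R]_n) : Prop := psd (B - A).

Definition twice_differentiable {n k : nat} (g : 'rV[R]_n -> 'rV[R]_k) : Prop :=
  (forall x, differentiable g x) /\ (forall x, differentiable (jacobian g) x).

Definition gradient {n : nat} (g : 'rV[R]_n -> R) (x : 'rV[R]_n) : 'rV[R]_n :=
  \row_(j < n) 'D_(delta_mx ord0 j) g x.

Definition hessian {n : nat} (g : 'rV[R]_n -> R) (x : 'rV[R]_n) : 'M[R]_n :=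
  \matrix_(i < n, j < n) 'D_(delta_mx ord0 i) ('D_(delta_mx ord0 j) g) x.

End euclidean.

Section conditional.
Context {d : measure_display} {Omega : measurableType d} {R : realType}.
Variables (P : probability Omega R) (G : set (set Omega)).

(* [Y] is a version of E[X | G]; the sigma-algebra [G] is meant to be contained
   in the one of [Omega]. *)
Definition is_cond_exp (X Y : Omega -> R) : Prop :=
  [/\ P.-integrable setT (EFin \o X),
      P.-integrable setT (EFin \o Y),
      preimage_set_system setT Y measurable `<=` G &
      forall B, G B -> (\int[P]_(w in B) (Y w)%:E = \int[P]_(w in B) (X w)%:E)%E].

Definition is_cond_exp_rV {n : nat} (X Y : Omega -> 'rV[R]_n) : Prop :=
  forall i : 'I_n, is_cond_exp (fun w => X w ord0 i) (fun w => Y w ord0 i).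

(* When [m] is a version of E[X | G], [C] is a version of
   Cov(X | G) = E[(X - E[X | G]) (X - E[X | G])^T | G];
   vectors are rows here, hence the position of the transpose. *)
Definition is_cond_cov {n : nat} (X m : Omega -> 'rV[R]_n)
    (C : Omega -> 'M[R]_n) : Prop :=
  forall i j : 'I_n,
    is_cond_exp (fun w => ((X w - m w)^T *m (X w - m w)) i j)
                (fun w => C w i j).

End conditional.

Section filtrations.
Context {d dA : measure_display} {Omega : measurableType d}
  {A : measurableType dA} {R : realType} {n : nat}.
Variables (x : nat -> Omega -> 'rV[R]_n) (ahat : nat -> Omega -> A).

(* sigma(x_{1:p}, ahat_{1:q}) *)
Definition history (p q : nat) : set (set Omega) :=
  <<s (\bigcup_(s in [set s | (1 <= s <= p)%N])
         preimage_set_system setT (x s) measurable) `|`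
      (\bigcup_(s in [set s | (1 <= s <= q)%N])
         preimage_set_system setT (ahat s) measurable) >>.

Definition filtF (t : nat) := history t t.

Definition filtF' (t : nat) := history t t.+1.

End filtrations.

(* Main.v *)
From mathcomp Require Import ring lra.
From mathcomp Require Import measurable_realfun.
Require Import Defs.

(* Fix a time t and a coordinate i, and write g := e_t(., ahat_t)_i,
   m := E[x_t | G], h := x_t - m. Since ahat_t and m are G-measurable, so are
   g(m) and v := grad g(m). Taylor's formula gives g(x_t) = g(m) + <v, h> + rem
   with |rem| <= gamma eps^2 / 2, hence
     g(x_t)^2 >= 2 g(m) <v, h> + <v, h>^2 - beta gamma eps^3.
   Conditionally on G the first term has mean 0 and the second one has mean
   <v, Cov v> >= sigma |v|^2, so that
     sigma E|v|^2 <= E g(x_t)^2 + beta gamma eps^3.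
   The gradient is gamma-Lipschitz, so |grad g(x_t)|^2 <= 2 |v|^2 + 2 gamma^2 eps^2.
   Summing over t and i yields the bound. *)

Set Implicit Arguments.
Unset Strict Implicit.
Unset Printing Implicit Defensive.

Import Order.TTheory GRing.Theory Num.Theory.
Import numFieldNormedType.Exports.

Local Open Scope classical_set_scope.
Local Open Scope ring_scope.

(** The expansion is made at m rather than at x_t because the gradient at m is G-measurable and can
    be pulled out of conditional moments; moving back to x_t costs the term 2 k gamma^2 eps^2 T.
    Three obstacles shape the rest. The bounds on gradient and Hessian hold only on the ball, so
    Taylor's formula at m requires m to lie there almost surely; m is known only through its
    integrals over events of G, and this is derived by testing against a suitable field.
    Conditioning is not an operator here: every conditional step says that a G-measurable weight
    times a centered variable integrates to 0, and the integrability of that product must be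
    supplied each time. Finally, the weight g(m) is not bounded by any hypothesis; its integrability
    comes from the finite regret, which makes g(x_t)^2 integrable, together with the Lipschitz
    bound. The constant beta gamma eps^3 is twice the product of the remainder bound gamma eps^2 / 2
    and the bound beta eps on <v, h>. Different times interact only through linearity of the
    expectation, so G, m and the covariance may be chosen afresh for each t. *)

Section dot_product.
Context {R : realType} {n : nat}.
Implicit Types u v w : 'rV[R]_n.

Definition dot u v : R := \sum_(i < n) u ord0 i * v ord0 i.

Lemma dotC u v : dot u v = dot v u.
Proof. by apply: eq_bigr => i _; rewrite mulrC. Qed.

Lemma dotDl u v w : dot (u + v) w = dot u w + dot v w.
Proof. by rewrite -big_split; apply: eq_bigr => i _; rewrite mxE mulrDl. Qed.

Lemma dotZl c u v : dot (c *: u) v = c * dot u v.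
Proof. by rewrite mulr_sumr; apply: eq_bigr => i _; rewrite mxE mulrA. Qed.

Lemma dotNl u v : dot (- u) v = - dot u v.
Proof. by rewrite -scaleN1r dotZl mulN1r. Qed.

Lemma dotBl u v w : dot (u - v) w = dot u w - dot v w.
Proof. by rewrite dotDl dotNl. Qed.

Lemma dotDr u v w : dot u (v + w) = dot u v + dot u w.
Proof. by rewrite dotC dotDl !(dotC u). Qed.

Lemma dotZr c u v : dot u (c *: v) = c * dot u v.
Proof. by rewrite dotC dotZl (dotC u). Qed.

Lemma dotBr u v w : dot u (v - w) = dot u v - dot u w.
Proof. by rewrite dotC dotBl !(dotC u). Qed.

Lemma dot0l v : dot 0 v = 0.
Proof. by apply: big1 => i _; rewrite mxE mul0r. Qed.

Lemma enorm_ge0 u : 0 <= enorm u.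
Proof. exact: sqrtr_ge0. Qed.

Lemma enorm_sqr u : enorm u ^+ 2 = dot u u.
Proof.
rewrite sqr_sqrtr; first by apply: eq_bigr => i _; rewrite expr2.
by apply: sumr_ge0 => i _; exact: sqr_ge0.
Qed.

Lemma enorm0 : enorm (0 : 'rV[R]_n) = 0.
Proof. by apply/eqP; rewrite -sqrf_eq0 enorm_sqr dot0l. Qed.

Lemma enorm_eq0 u : enorm u = 0 -> u = 0.
Proof.
move=> u0; apply/rowP => i; rewrite mxE; apply/eqP; rewrite -sqrf_eq0.
have := enorm_sqr u; rewrite u0 expr0n/= => /esym/eqP.
by rewrite psumr_eq0 ?[_ == 0]/= => [/allP/(_ i)|j _];
  rewrite -expr2 ?sqr_ge0// mem_index_enum => /(_ isT).
Qed.

(** Cauchy-Schwarz, from expanding the squared norm of |v| u - |u| v, which equals 2 |u| |v| (|u|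
    |v| - <u, v>). *)
Lemma dot_le_enorm u v : dot u v <= enorm u * enorm v.
Proof.
have [/eqP u0|u0] := boolP (enorm u == 0).
  by rewrite (enorm_eq0 u0) dot0l enorm0 mul0r.
have [/eqP v0|v0] := boolP (enorm v == 0).
  by rewrite (enorm_eq0 v0) dotC dot0l enorm0 mulr0.
have uv : 0 < enorm u * enorm v by rewrite mulr_gt0// lt0r ?u0 ?v0 enorm_ge0.
have := sqr_ge0 (enorm (enorm v *: u - enorm u *: v)).
rewrite enorm_sqr !(dotBl, dotBr, dotZl, dotZr) -!enorm_sqr (dotC v u).
rewrite (_ : _ - _ = 2 * (enorm u * enorm v) * (enorm u * enorm v - dot u v)).
  by rewrite pmulr_rge0 ?subr_ge0// mulr_gt0.
by ring.
Qed.

Lemma enormZ c u : enorm (c *: u) = `|c| * enorm u.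
Proof.
apply/eqP; rewrite -(@eqrXn2 _ 2) ?mulr_ge0 ?enorm_ge0//.
by rewrite exprMn !enorm_sqr dotZl dotZr real_normK ?num_real// expr2 mulrA.
Qed.

Lemma enormN u : enorm (- u) = enorm u.
Proof. by rewrite -scaleN1r enormZ normrN1 mul1r. Qed.

Lemma normr_dot_le u v : `|dot u v| <= enorm u * enorm v.
Proof.
by rewrite ler_norml dot_le_enorm andbT lerNl -dotNl -(enormN u) dot_le_enorm.
Qed.

Lemma enormD u v : enorm (u + v) <= enorm u + enorm v.
Proof.
rewrite -(@ler_pXn2r _ 2) ?nnegrE ?addr_ge0 ?enorm_ge0//.
rewrite enorm_sqr !(dotDl, dotDr) sqrrD -!enorm_sqr (dotC v u).
have := dot_le_enorm u v; lra.
Qed.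

Lemma enorm_le_of_dot (c : R) u : 0 <= c ->
  enorm u ^+ 2 <= c * enorm u -> enorm u <= c.
Proof.
move=> c0; have [->//|u0] := eqVneq (enorm u) 0.
by rewrite expr2 ler_pM2r// lt0r u0 enorm_ge0.
Qed.

Lemma normr_coord_le u i : `|u ord0 i| <= enorm u.
Proof.
rewrite -(@ler_pXn2r _ 2) ?nnegrE ?enorm_ge0// real_normK ?num_real//.
rewrite enorm_sqr /dot (bigD1 i)//= -expr2 lerDl.
by apply: sumr_ge0 => j _; rewrite -expr2 sqr_ge0.
Qed.

Lemma cball0_segment (r : R) u v (s : R) : 0 <= s <= 1 ->
  cball0 r u -> cball0 r (u + v) -> cball0 r (u + s *: v).
Proof.
rewrite /cball0/= => /andP[s0 s1] ru rv.
rewrite (_ : u + s *: v = (1 - s) *: u + s *: (u + v)); last first.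
  by rewrite scalerBl scale1r scalerDr addrA subrK.
apply: le_trans (enormD _ _) _; rewrite !enormZ !ger0_norm ?subr_ge0//.
have := ler_wpM2l s0 rv; have s1' : 0 <= 1 - s by rewrite subr_ge0.
have := ler_wpM2l s1' ru.
lra.
Qed.

End dot_product.

(** * Spectral norm as an operator bound *)

Section spectral.
Context {R : realType}.

Lemma dot_mulmx (m n : nat) (v : 'rV[R]_m) (M : 'M[R]_(m, n)) (w : 'rV[R]_n) :
  dot (v *m M) w = \sum_(i < m) \sum_(j < n) v ord0 i * M i j * w ord0 j.
Proof.
rewrite exchange_big/=; apply: eq_bigr => j _.
by rewrite mxE mulr_suml.
Qed.

(** Boundedness is what allows a value to be compared with the [sup]. Each coordinate of v M is at
    most a column sum of absolute values, so |v M|^2 <= S; the bound 1 + S avoids a square root,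
    since S <= (1 + S)^2. *)
Lemma has_ubound_spectral (m n : nat) (M : 'M[R]_(m, n)) :
  has_ubound [set enorm (v *m M) | v in @cball0 R m 1].
Proof.
exists (1 + \sum_(j < n) (\sum_(i < m) `|M i j|) ^+ 2) => _ [v v1 <-].
set S := \sum_(j < n) _.
have S0 : 0 <= S by apply: sumr_ge0 => j _; exact: sqr_ge0.
rewrite -(@ler_pXn2r _ 2) ?nnegrE ?enorm_ge0 ?addr_ge0//.
rewrite (@le_trans _ _ S)//; last by nra.
rewrite enorm_sqr; apply: ler_sum => j _; rewrite -expr2.
rewrite -[leLHS]real_normK ?num_real// ler_pXn2r ?nnegrE ?sumr_ge0//.
rewrite mxE (le_trans (ler_norm_sum _ _ _))//; apply: ler_sum => i _.
rewrite normrM ler_piMl// (le_trans (normr_coord_le _ _))//.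
Qed.

Lemma enorm_mulmx_le (m n : nat) (v : 'rV[R]_m) (M : 'M[R]_(m, n)) :
  enorm (v *m M) <= spectral_norm M * enorm v.
Proof.
have [/enorm_eq0 ->|v0] := eqVneq (enorm v) 0.
  by rewrite mul0mx !enorm0 mulr0.
have v_gt0 : 0 < enorm v by rewrite lt0r v0 enorm_ge0.
rewrite -ler_pdivrMr// mulrC.
rewrite -[X in X * _]ger0_norm ?invr_ge0 ?enorm_ge0// -enormZ scalemxAl.
apply: ub_le_sup; first exact: has_ubound_spectral.
exists ((enorm v)^-1 *: v) => //; rewrite /cball0/= enormZ.
by rewrite ger0_norm ?invr_ge0 ?enorm_ge0// mulVf.
Qed.

End spectral.

(** * Derivatives along a line *)

Section directional_derivative.
Context {R : realType} {n : nat}.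
Implicit Types (g : 'rV[R]_n -> R) (u h v : 'rV[R]_n).

Lemma derive_coordE g u v : differentiable g u ->
  'D_v g u = \sum_(j < n) v ord0 j * 'D_(delta_mx ord0 j) g u.
Proof.
move=> dg; rewrite deriveE// {1}[v]row_sum_delta linear_sum/=.
by apply: eq_bigr => j _; rewrite linearZ/= deriveE.
Qed.

Lemma derive_gradient g u v : differentiable g u ->
  'D_v g u = dot (gradient g u) v.
Proof.
move=> dg; rewrite derive_coordE//; apply: eq_bigr => j _.
by rewrite mxE mulrC.
Qed.

(** The difference quotients of the two derivatives are literally the same function, so both
    existence and value transfer. *)
Lemma is_derive_line g u h (s : R) : differentiable g (u + s *: h) ->
  is_derive s 1 (fun r : R => g (u + r *: h)) ('D_h g (u + s *: h)).
Proof.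
move=> /(@diff_derivable _ _ _ _ _ h) dg.
have E : (fun r : R => r^-1 *: (((fun r : R => g (u + r *: h)) \o shift s) (r *: (1 : R))
                             - g (u + s *: h)))
    = (fun r : R => r^-1 *: ((g \o shift (u + s *: h)) (r *: h) - g (u + s *: h))).
  apply/funext => r /=; congr (_ *: (g _ - _)).
  by rewrite [r *: 1]mulr1 scalerDl addrCA.
by split; rewrite /derivable /derive E.
Qed.

(** The row index of [hessian] is the outer derivative, so the direction of travel [h] multiplies on
    the left and the test vector [w] on the right. *)
Lemma is_derive_line_gradient g u h w (s : R) :
  (forall j y, differentiable (fun z => 'D_(delta_mx ord0 j) g z) y) ->
  is_derive s 1 (fun r : R => dot (gradient g (u + r *: h)) w)
    (dot (h *m hessian g (u + s *: h)) w).
Proof.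
move=> dg.
have -> : (fun r : R => dot (gradient g (u + r *: h)) w) =
    \sum_(j < n) (w ord0 j \*: (fun r : R => 'D_(delta_mx ord0 j) g (u + r *: h))).
  apply/funext => r; rewrite fct_sumE; apply: eq_bigr => j _.
  by rewrite mxE mulrC.
have H j := @is_derive_line _ _ _ s (dg j (u + s *: h)).
apply: is_derive_eq.
rewrite dot_mulmx exchange_big/=; apply: eq_bigr => j _.
rewrite derive_coordE// scaler_sumr; apply: eq_bigr => i _.
by rewrite mxE [LHS]mulrC.
Qed.

End directional_derivative.

Lemma is_derive_within_continuous (R : realType) (f df : R -> R) (a b : R) :
  (forall s : R, is_derive s (1 : R) f (df s)) -> {within `[a, b], continuous f}.
Proof.
by move=> fdf; apply: derivable_within_continuous => s _; exact: ex_derive.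
Qed.

(** * Mean value estimates inside the ball *)

Section smooth_on_ball.
Context {R : realType} {n : nat} (g : 'rV[R]_n -> R) (r beta gamma : R).
Hypothesis dg : forall y, differentiable g y.
Hypothesis d2g :
  forall j y, differentiable (fun z => 'D_(delta_mx ord0 j) g z) y.
Hypothesis gamma0 : 0 <= gamma.
Hypothesis grad_le : forall y, cball0 r y -> enorm (gradient g y) <= beta.
Hypothesis hess_le : forall y, cball0 r y -> spectral_norm (hessian g y) <= gamma.
Variables u h : 'rV[R]_n.
Hypotheses (ru : cball0 r u) (ruh : cball0 r (u + h)).

(** The segment from u to u + h stays in the ball by convexity, so the mean value point does too.
    The estimate serves to make g(m) integrable. *)
Lemma lipschitz_ball : `|g (u + h) - g u| <= beta * enorm h.
Proof.
have der (s : R) : is_derive s 1 (fun s : R => g (u + s *: h)) ('D_h g (u + s *: h)).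
  exact: is_derive_line.
have [|s s01] := @MVT_segment _ _ _ 0 1 ler01 (fun s _ => der s).
  exact: is_derive_within_continuous der.
rewrite scale0r addr0 scale1r subr0 mulr1 => ->.
rewrite derive_gradient// (le_trans (normr_dot_le _ _))// ler_wpM2r ?enorm_ge0//.
by apply: grad_le; apply: cball0_segment.
Qed.

(** The mean value theorem is scalar, so the gradient is tested against a fixed [w]. Taking [w] to
    be the increment of the gradient then gives the norm bound, after cancelling one factor. *)
Lemma gradient_lipschitz_dot w :
  `|dot (gradient g (u + h)) w - dot (gradient g u) w| <= gamma * enorm h * enorm w.
Proof.
have der (s : R) := is_derive_line_gradient u h w s d2g.
have [|s s01] := @MVT_segment _ _ _ 0 1 ler01 (fun s _ => der s).
  exact: is_derive_within_continuous der.
rewrite scale0r addr0 scale1r subr0 mulr1 => ->.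
rewrite (le_trans (normr_dot_le _ _))// ler_wpM2r ?enorm_ge0//.
rewrite (le_trans (enorm_mulmx_le _ _))// ler_wpM2r ?enorm_ge0//.
by apply: hess_le; apply: cball0_segment.
Qed.

Lemma gradient_lipschitz : enorm (gradient g (u + h) - gradient g u) <= gamma * enorm h.
Proof.
apply: enorm_le_of_dot; first by rewrite mulr_ge0 ?enorm_ge0.
rewrite enorm_sqr dotBl (le_trans (ler_norm _))//.
exact: gradient_lipschitz_dot.
Qed.

End smooth_on_ball.

(** * Second-order Taylor remainder *)

Section taylor.
Context {R : realType} {n : nat} (g : 'rV[R]_n -> R) (r gamma : R).
Hypothesis dg : forall y, differentiable g y.
Hypothesis d2g :
  forall j y, differentiable (fun z => 'D_(delta_mx ord0 j) g z) y.
Hypothesis hess_le : forall y, cball0 r y -> spectral_norm (hessian g y) <= gamma.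
Variables u h : 'rV[R]_n.
Hypotheses (ru : cball0 r u) (ruh : cball0 r (u + h)).

(* The remainder s |-> c (g (u + s h) - g u - s <grad g u, h>) - gamma s^2 |h|^2 / 2
   has a nonpositive derivative, by the Lipschitz bound on the gradient. *)
Let taylor_sign (c : R) : `|c| = 1 ->
  c * (g (u + h) - g u - dot (gradient g u) h) <= gamma / 2 * enorm h ^+ 2.
Proof.
move=> c1.
pose psi (s : R) : R := c * g (u + s *: h) + (- (c * dot (gradient g u) h)) * s
                        + (- (gamma / 2 * enorm h ^+ 2)) * s ^+ 2.
have der (s : R) : is_derive s 1 psi
   (c * (dot (gradient g (u + s *: h)) h - dot (gradient g u) h)
    - gamma * s * enorm h ^+ 2).
  have -> : psi = (c \*: (fun s : R => g (u + s *: h))) +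
                  ((- (c * dot (gradient g u) h)) \*: id) +
                  ((- (gamma / 2 * enorm h ^+ 2)) \*: (fun s => s ^+ 2)) by [].
  have dline := is_derive_line (dg (u + s *: h)).
  have dsqr : is_derive s 1 (fun s : R => s ^+ 2) (2 * s).
    split; first exact: exprn_derivable.
    by rewrite exp_derive /GRing.scale/= expr1 mulr1.
  have dpsi := @is_deriveD _ _ _ _ _ _ _ _ _
    (@is_deriveD _ _ _ _ _ _ _ _ _ (@is_deriveZ _ _ _ _ c _ _ _ dline)
      (@is_deriveZ _ _ _ _ (- (c * dot (gradient g u) h)) _ _ _ (is_derive_id s 1)))
    (@is_deriveZ _ _ _ _ (- (gamma / 2 * enorm h ^+ 2)) _ _ _ dsqr).
  apply: (is_derive_eq dpsi).
  by rewrite derive_gradient// /GRing.scale/= !mulr1; field.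
have [|s s01] := @MVT_segment _ _ _ 0 1 ler01 (fun s _ => der s).
  exact: is_derive_within_continuous der.
rewrite /psi scale0r addr0 scale1r subr0 mulr1 !mulr0 !mulr1 expr1n expr0n/= !mulr1 !mulr0 => E.
have /andP[s0 s1] : 0 <= s <= 1 by rewrite in_itv/= in s01.
have L : c * (dot (gradient g (u + s *: h)) h - dot (gradient g u) h)
    <= gamma * s * enorm h ^+ 2.
  rewrite (le_trans (ler_norm _))// normrM c1 mul1r.
  rewrite (le_trans (@gradient_lipschitz_dot _ _ g r gamma d2g hess_le _ _ ru _ h))//.
    by apply: cball0_segment => //; rewrite s0.
  by rewrite enormZ ger0_norm// expr2 !mulrA.
lra.
Qed.

Lemma taylor_remainder :
  `|g (u + h) - g u - dot (gradient g u) h| <= gamma / 2 * enorm h ^+ 2.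
Proof.
rewrite ler_norml; have := @taylor_sign 1 (normr1 _).
have := @taylor_sign (-1) (normrN1 _).
by rewrite mulN1r mul1r lerNl => -> ->.
Qed.

End taylor.

(** * From the Jacobian to gradients of coordinates *)

Section coordinates.
Context {R : realType} {n k : nat} (g : 'rV[R]_n -> 'rV[R]_k).

Lemma differentiable_row_coord y i :
  differentiable g y -> differentiable (fun z => g z ord0 i) y.
Proof.
move=> dg; apply: (@differentiable_comp _ _ _ _ g (fun N : 'rV[R]_k => N ord0 i)) => //.
exact: differentiable_coord.
Qed.

Lemma derive_row_coord y i j : differentiable g y ->
  'D_(delta_mx ord0 j) (fun z => g z ord0 i) y = jacobian g y j i.
Proof.
move=> dg; have := deriveEjacobian (delta_mx ord0 j) dg.
rewrite -rowE derive_mx; last exact: diff_derivable.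
by move=> /rowP/(_ i); rewrite !mxE.
Qed.

Lemma differentiable_derive_row_coord i j : twice_differentiable g ->
  forall y, differentiable (fun z => 'D_(delta_mx ord0 j) (fun z' => g z' ord0 i) z) y.
Proof.
move=> [dg d2g] y.
have -> : (fun z => 'D_(delta_mx ord0 j) (fun z' => g z' ord0 i) z) =
    (fun M : 'M[R]_(n, k) => M j i) \o jacobian g.
  by apply/funext => z /=; rewrite derive_row_coord.
apply: differentiable_comp => //; exact: differentiable_coord.
Qed.

Lemma frobenius_norm_jacobian y : differentiable g y ->
  frobenius_norm (jacobian g y) ^+ 2 =
  \sum_(i < k) enorm (gradient (fun z => g z ord0 i) y) ^+ 2.
Proof.
move=> dg; rewrite sqr_sqrtr; last first.
  by apply: sumr_ge0 => i _; apply: sumr_ge0 => j _; exact: sqr_ge0.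
rewrite exchange_big/=; apply: eq_bigr => i _.
rewrite enorm_sqr; apply: eq_bigr => j _.
by rewrite -derive_row_coord// expr2 /gradient !mxE.
Qed.

End coordinates.

(** * Measurability of vector-valued maps *)

Section measurability_rV.
Context {R : realType} {d : measure_display} {T : measurableType d}.

Lemma measurable_row_coord (n : nat) (i : 'I_n) :
  measurable_fun [set: 'rV[R]_n] (fun v : 'rV[R]_n => v ord0 i).
Proof.
move=> _ Y mY; rewrite setTI; apply: sub_sigma_algebra => /=.
rewrite -bigcup_seq/=; exists i => /=; first by rewrite mem_index_enum.
by exists Y => //; rewrite setTI.
Qed.

Lemma measurable_fun_rowP (n : nat) (f : T -> 'rV[R]_n) :
  measurable_fun [set: T] f <->
  forall i, measurable_fun [set: T] (fun w => f w ord0 i).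
Proof.
split=> [mf i|mf].
  by apply: (measurableT_comp (@measurable_row_coord n i)).
apply: (measurability (\big[setU/set0]_(i < n)
  preimage_set_system setT (fun v : 'rV[R]_n => v ord0 i) measurable)) => //.
move=> _ [B + <-]; rewrite -bigcup_seq => -[i _ [C mC <-]].
by rewrite !setTI -comp_preimage -[X in measurable X]setTI; exact: mf.
Qed.

Lemma measurable_dot (n : nat) (f g : T -> 'rV[R]_n) :
  measurable_fun [set: T] f -> measurable_fun [set: T] g ->
  measurable_fun [set: T] (fun w => dot (f w) (g w)).
Proof.
move=> /measurable_fun_rowP mf /measurable_fun_rowP mg.
by apply: measurable_sum => i; exact: measurable_funM.
Qed.

Lemma measurable_enorm (n : nat) (f : T -> 'rV[R]_n) :
  measurable_fun [set: T] f -> measurable_fun [set: T] (fun w => enorm (f w)).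
Proof.
move=> mf; have -> : (fun w => enorm (f w)) = Num.sqrt \o (fun w => dot (f w) (f w)).
  by apply/funext => w /=; rewrite -enorm_sqr sqrtr_sqr ger0_norm// enorm_ge0.
apply: measurableT_comp; last exact: measurable_dot.
exact: (continuous_measurable_fun (@sqrt_continuous R)).
Qed.

End measurability_rV.

(** * Joint measurability of the gradient *)

Section measurable_derivative.
Context {R : realType} {n : nat} {d : measure_display} {A : measurableType d}.

(** The derivative is a pointwise limit of measurable difference quotients with steps 1/(m+1).
    Measurability is joint in the point and the parameter so that both can later be replaced by
    random variables. *)
Lemma measurable_derive (F : 'rV[R]_n -> A -> R) (v : 'rV[R]_n) :
  measurable_fun [set: 'rV[R]_n * A] (fun p => F p.1 p.2) ->
  (forall y a, derivable (fun z => F z a) y v) ->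
  measurable_fun [set: 'rV[R]_n * A] (fun p => 'D_v (fun z => F z p.2) p.1).
Proof.
move=> mF dF.
pose q (m : nat) (p : 'rV[R]_n * A) : R :=
  m.+1%:R * (F (m.+1%:R^-1 *: v + p.1) p.2 - F p.1 p.2).
apply: (@measurable_fun_cvg _ _ _ _ q) => [m|p _].
- apply: measurable_funM => //; apply: measurable_funB => //.
  have mshift : measurable_fun [set: 'rV[R]_n * A]
      (fun p => (m.+1%:R^-1 *: v + p.1, p.2)).
    apply: measurable_fun_pair => //; apply/measurable_fun_rowP => i.
    under eq_fun do rewrite !mxE.
    apply: measurable_funD => //.
    exact: (measurableT_comp (@measurable_row_coord _ n i)).
  exact: (measurableT_comp mF mshift).
(* The limit over the punctured neighbourhood is restricted to the right of 0, then to the harmonic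
   sequence. *)
- have /cvg_dnbhs_at_right/cvg_at_rightP := dF p.1 p.2.
  move=> /(_ (@harmonic R)); rewrite -/('D_v (F^~ p.2) p.1) => cv.
  have {cv} := cv (conj (fun m => harmonic_gt0 m) cvg_harmonic).
  apply: cvg_trans; apply: near_eq_cvg; apply: nearW => m.
  by rewrite /q /harmonic/= invrK.
Qed.

Lemma measurable_gradient (F : 'rV[R]_n -> A -> R) (d' : measure_display)
    (T : measurableType d') (y : T -> 'rV[R]_n) (a : T -> A) :
  measurable_fun [set: 'rV[R]_n * A] (fun p => F p.1 p.2) ->
  (forall z b, differentiable (fun z => F z b) z) ->
  measurable_fun [set: T] y -> measurable_fun [set: T] a ->
  measurable_fun [set: T] (fun w => gradient (fun z => F z (a w)) (y w)).
Proof.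
move=> mF dF my ma; apply/measurable_fun_rowP => j.
under eq_fun do rewrite mxE.
have mD := @measurable_derive F (delta_mx ord0 j) mF
  (fun z b => @diff_derivable _ _ _ _ _ _ (dF z b)).
exact: (measurableT_comp mD (measurable_fun_pair my ma)).
Qed.

End measurable_derivative.

(** * Real-valued integrals under almost sure bounds *)

Section integral_helpers.
Context {d : measure_display} {T : measurableType d} {R : realType}.
Variable P : probability T R.
Implicit Types f g : T -> R.

Local Notation integrableR f := (P.-integrable setT (EFin \o f)).

Lemma ae_bounded_integrable f (c : R) : measurable_fun setT f ->
  {ae P, forall w, `|f w| <= c} -> integrableR f.
Proof.
move=> mf fc; apply/integrableP; split; first exact/measurable_EFinP.
apply: (@le_lt_trans _ _ (\int[P]_w (`|c|%:E))%E).
  apply: ae_ge0_le_integral => //.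
  - exact/measurableT_comp/measurable_EFinP.
  - apply: filterS fc => w /= fwc _; rewrite lee_fin.
    by rewrite (le_trans fwc)// ler_norm.
by rewrite integral_cst//= probability_setT mule1 ltry.
Qed.

Lemma integrable_EFinD f g : integrableR f -> integrableR g -> integrableR (fun w => f w + g w).
Proof. by move=> If Ig; apply: (integrableD measurableT If Ig). Qed.

Lemma integrable_EFinZ (c : R) f : integrableR f -> integrableR (fun w => c * f w).
Proof. by move=> If; apply: (integrableZl measurableT c If). Qed.

Lemma integrable_EFin_sum (I : Type) (s : seq I) (F : I -> T -> R) :
  (forall i, integrableR (F i)) -> integrableR (fun w => \sum_(i <- s) F i w).
Proof.
move=> IF; have := @integrable_sum _ _ _ P setT measurableT _ s xpredT
  (fun i => EFin \o F i) (fun i _ => IF i).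
by apply: eq_integrable => // w _ /=; rewrite sumEFin.
Qed.

Lemma integrable_EFin_cst (c : R) : integrableR (fun=> c).
Proof. exact: finite_measure_integrable_cst. Qed.

Lemma integrable_EFin_measurable f : integrableR f -> measurable_fun setT f.
Proof. by move=> /measurable_int/measurable_EFinP. Qed.

Lemma ae_le_integrable f g : measurable_fun setT f -> integrableR g ->
  {ae P, forall w, `|f w| <= `|g w|} -> integrableR f.
Proof.
move=> mf Ig fg; have /integrableP[mg ig] := Ig.
apply/integrableP; split; first exact/measurable_EFinP.
apply: le_lt_trans ig; apply: ae_ge0_le_integral => //.
- exact/measurableT_comp/measurable_EFinP.
- exact/measurableT_comp.
- by apply: filterS fg => w /= fgw _; rewrite lee_fin.
Qed.

Lemma RintegralDT f g : integrableR f -> integrableR g ->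
  \int[P]_w (f w + g w) = \int[P]_w f w + \int[P]_w g w.
Proof. exact: RintegralD. Qed.

Lemma RintegralZT (c : R) f : integrableR f -> \int[P]_w (c * f w) = c * \int[P]_w f w.
Proof. exact: RintegralZl. Qed.

Lemma Rintegral_sumT (I : Type) (s : seq I) (F : I -> T -> R) :
  (forall i, integrableR (F i)) ->
  \int[P]_w (\sum_(i <- s) F i w) = \sum_(i <- s) \int[P]_w F i w.
Proof.
move=> IF; elim: s => [|i s IH].
  rewrite big_nil; under eq_Rintegral do rewrite big_nil.
  by rewrite Rintegral_cst// mul0r.
rewrite big_cons -IH -RintegralDT//; last exact: integrable_EFin_sum.
by apply: eq_Rintegral => w _; rewrite big_cons.
Qed.

Lemma Rintegral_cstT (c : R) : \int[P]_w c = c.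
Proof. by rewrite Rintegral_cst//= probability_setT mulr1. Qed.

Lemma EFin_RintegralT f : integrableR f -> (\int[P]_w f w)%:E = (\int[P]_w (f w)%:E)%E.
Proof. by move=> If; rewrite /Rintegral fineK//; exact: integrable_fin_num. Qed.

(** [le_Rintegral] wants the inequality everywhere, so f is first replaced by min(f, g), which
    agrees with it almost surely. *)
Lemma ae_le_Rintegral f g : integrableR f -> integrableR g ->
  {ae P, forall w, f w <= g w} -> \int[P]_w f w <= \int[P]_w g w.
Proof.
move=> If Ig fg.
have mf := integrable_EFin_measurable If; have mg := integrable_EFin_measurable Ig.
have mm : measurable_fun setT (fun w => Num.min (f w) (g w)) by exact: measurable_minr.
have E : {ae P, forall w, f w = Num.min (f w) (g w)}.
  by apply: filterS fg => w fgw; rewrite min_l.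
have Im : integrableR (fun w => Num.min (f w) (g w)).
  by apply: ae_le_integrable If _ => //; apply: filterS E => w <-.
have -> : \int[P]_w f w = \int[P]_w Num.min (f w) (g w).
  congr fine; apply: ae_eq_integral => //; try exact/measurable_EFinP.
  by apply: filterS E => w <- _.
by apply: le_Rintegral => // w _; rewrite ge_min lexx orbT.
Qed.

End integral_helpers.

(** * Pulling G-measurable factors out of centered integrals *)

Section pull_out.
Import HBNNSimple.
Context {d : measure_display} {T : measurableType d} {R : realType}.
Variables (P : probability T R) (G : set (set T)).
Hypotheses (sG : sigma_algebra setT G) (Gm : G `<=` measurable).

Local Notation integrableR f := (P.-integrable setT (EFin \o f)).
Local Notation TG := (g_sigma_algebraType G).

Lemma g_sigma_algebra_sub (B : set T) : (measurable : set (set TG)) B -> G B.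
Proof. by rewrite /measurable/= sigma_algebra_id. Qed.

Lemma measurable_fun_sub (d' : measure_display) (U : measurableType d') (f : T -> U) :
  measurable_fun (setT : set TG) f -> measurable_fun (setT : set T) f.
Proof.
move=> mf _ B mB; apply: Gm; apply: g_sigma_algebra_sub.
exact: mf.
Qed.

Lemma measurable_fun_subP (d' : measure_display) (U : measurableType d') (f : T -> U) :
  preimage_set_system setT f measurable `<=` G -> measurable_fun (setT : set TG) f.
Proof.
by move=> fG _ B mB; apply: sub_sigma_algebra; apply: fG; exists B.
Qed.

Variable Y : T -> R.
Hypothesis IY : integrableR Y.
Hypothesis Y0 : forall B, G B -> (\int[P]_(w in B) (Y w)%:E = 0)%E.

(** The level sets of a simple function on [TG] belong to G, and Y integrates to 0 over each of
    them. *)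
Let pull_out_nnsfun (s : {nnsfun TG >-> R}) : 
  (\int[P]_w (s w * Y w)%:E = 0)%E.
Proof.
have E w : (s w * Y w)%:E =
    (\sum_(y <- finmap.enum_fset (fset_set (range s)))
       y%:E * ((EFin \o Y) \_ (s @^-1` [set y])) w)%E.
  rewrite fimfunE fsbig_finite//= mulr_suml -sumEFin.
  apply: eq_bigr => y _; rewrite patchE indicE.
  by case: (w \in _); rewrite ?mulr1 ?mulr0 ?mul0r ?mule0// EFinM.
have mS y : G (s @^-1` [set y]).
  by apply: g_sigma_algebra_sub; exact: (measurable_funPTI s).
have IYS y : P.-integrable setT ((EFin \o Y) \_ (s @^-1` [set y])).
  have mSy : d.-measurable (s @^-1` [set y]) by apply: Gm; exact: mS.
  by apply/(integrable_mkcond _ mSy); exact: integrableS IY.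
under eq_integral do rewrite E.
rewrite integral_sum//; last by move=> y; apply: integrableZl.
by apply: big1 => y _; rewrite integralZl// -integral_mkcond Y0// mule0.
Qed.

(** Simple functions s_n increase to Z with 0 <= s_n <= Z, so |Z Y| dominates every s_n Y. *)
Let pull_out_ge0 (Z : T -> R) : (forall w, 0 <= Z w) ->
  measurable_fun (setT : set TG) Z -> integrableR (fun w => Z w * Y w) ->
  \int[P]_w (Z w * Y w) = 0.
Proof.
move=> Z0 mZ IZY.
have mZE : measurable_fun (setT : set TG) (EFin \o Z) by exact/measurable_EFinP.
pose s n : {nnsfun TG >-> R} := nnsfun_approx measurableT mZE n.
have cvs w : (s n w)%:E @[n --> \oo] --> (Z w)%:E.
  by apply: cvg_nnsfun_approx => // w' _; rewrite lee_fin.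
have sZ n w : s n w <= Z w.
  have cv : (s n w) @[n --> \oo] --> Z w by exact: (fine_cvg (cvs w)).
  rewrite -(cvg_lim (@Rhausdorff R) cv); apply: nondecreasing_cvgn_le; last first.
    by apply/cvg_ex; exists (Z w).
  by move=> m m' mm'; have /lefP := nd_nnsfun_approx measurableT mZE mm'; exact.
have mY : measurable_fun setT Y := integrable_EFin_measurable IY.
have mZT := measurable_fun_sub mZ.
have [] := @dominated_convergence _ T R P setT measurableT
  (fun n w => (s n w * Y w)%:E) (fun w => (Z w * Y w)%:E) (fun w => `|Z w * Y w|%:E).
- move=> n; apply/measurable_EFinP/measurable_funM => //.
  by apply: measurable_fun_sub; exact: measurable_funP.
- exact/measurable_EFinP/measurable_funM.
- apply: aeW => w _; apply: cvg_EFin; first exact: nearW.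
  by apply: cvgMl; exact: (fine_cvg (cvs w)).
- exact: integrable_abse IZY.
- apply: aeW => w n _; rewrite lee_fin !normrM ler_wpM2r//.
  by rewrite !ger0_norm.
move=> _ _; under eq_fun do rewrite pull_out_nnsfun.
move=> /(cvg_lim (@ereal_hausdorff R)); rewrite lim_cst// => E.
by rewrite /Rintegral -E.
Qed.

(** Integrability is asked of the product alone, which admits unbounded weights such as g(m). The
    parts of Z inherit it, since each is at most |Z|. *)
Lemma pull_out (Z : T -> R) : measurable_fun (setT : set TG) Z ->
  integrableR (fun w => Z w * Y w) -> \int[P]_w (Z w * Y w) = 0.
Proof.
move=> mZ IZY.
have mp : measurable_fun (setT : set TG) (Z^\+) by exact: measurable_funrpos.
have mn : measurable_fun (setT : set TG) (Z^\-) by exact: measurable_funrneg.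
have mY : measurable_fun setT Y := integrable_EFin_measurable IY.
have Ip : integrableR (fun w => Z^\+ w * Y w).
  apply: ae_le_integrable IZY _.
    by apply: measurable_funM => //; exact: measurable_fun_sub.
  apply: aeW => w; rewrite !normrM ler_wpM2r//.
  by rewrite /funrpos ger0_norm ?le_max ?lexx ?orbT// ge_max ler_norm normr_ge0.
have In : integrableR (fun w => Z^\- w * Y w).
  apply: ae_le_integrable IZY _.
    by apply: measurable_funM => //; exact: measurable_fun_sub.
  apply: aeW => w; rewrite !normrM ler_wpM2r//.
  rewrite /funrneg ger0_norm ?le_max ?lexx ?orbT// ge_max normr_ge0 andbT.
  by rewrite -normrN ler_norm.
have -> : \int[P]_w (Z w * Y w) = \int[P]_w (Z^\+ w * Y w + (-1) * (Z^\- w * Y w)).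
  apply: eq_Rintegral => w _; by rewrite -{1}(funrposBneg Z) mulN1r -mulNr -mulrDl.
rewrite RintegralDT//; last exact: integrable_EFinZ.
by rewrite RintegralZT// !pull_out_ge0 ?mulr0 ?addr0.
Qed.

End pull_out.

(** * Consequences for conditional means *)

Section conditional_moments.
Context {d : measure_display} {T : measurableType d} {R : realType}.
Variables (P : probability T R) (G : set (set T)).
Hypotheses (sG : sigma_algebra setT G) (Gm : G `<=` measurable).

Local Notation integrableR f := (P.-integrable setT (EFin \o f)).
Local Notation TG := (g_sigma_algebraType G).

Lemma integrable_sub_cond_exp (X Y : T -> R) : is_cond_exp P G X Y ->
  integrableR (fun w => X w - Y w).
Proof. by move=> [IX IY _ _]; exact: (integrableB measurableT IX IY). Qed.

Lemma cond_exp_pull_out (X Y Z : T -> R) : is_cond_exp P G X Y ->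
  measurable_fun (setT : set TG) Z ->
  integrableR (fun w => Z w * (X w - Y w)) -> \int[P]_w (Z w * (X w - Y w)) = 0.
Proof.
move=> XY mZ; apply: (@pull_out _ _ _ P G sG Gm (fun w => X w - Y w)) => //.
  exact: integrable_sub_cond_exp XY.
case: XY => IX IY _ E B GB; have mB := Gm GB.
under eq_integral do rewrite EFinB.
have IXB : P.-integrable B (EFin \o X) by exact: integrableS IX.
have IYB : P.-integrable B (EFin \o Y) by exact: integrableS IY.
rewrite (integralB mB IXB IYB) E// subee//; exact: integrable_fin_num IXB.
Qed.

Lemma measurable_cond_exp_rV (n : nat) (X m : T -> 'rV[R]_n) :
  is_cond_exp_rV P G X m -> measurable_fun (setT : set TG) m.
Proof.
move=> Xm; apply/measurable_fun_rowP => i; apply: measurable_fun_subP.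
by case: (Xm i).
Qed.

(* Test the centered vector X - m against the bounded G-measurable field
   m / (1 + |m|^2) on the event |m| > r. *)
Lemma cond_exp_cball0 (n : nat) (X m : T -> 'rV[R]_n) (r : R) :
  is_cond_exp_rV P G X m -> {ae P, forall w, cball0 r (X w)} ->
  {ae P, forall w, cball0 r (m w)}.
Proof.
move=> Xm Xr.
have mm := measurable_cond_exp_rV Xm.
have mnorm : measurable_fun (setT : set TG) (fun w => enorm (m w)).
  exact: measurable_enorm.
pose c w := (1 + enorm (m w) ^+ 2)^-1.
have mc : measurable_fun (setT : set TG) c.
  have cont : continuous (fun s : R => (1 + s ^+ 2)^-1).
    move=> s; apply: cvgV; first by rewrite gt_eqF// ltr_wpDr// sqr_ge0.
    by apply: cvgD; [exact: cvg_cst|exact: exprn_continuous].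
  exact: (measurableT_comp (continuous_measurable_fun cont) mnorm).
have c0 w : 0 < c w by rewrite invr_gt0 ltr_wpDr// sqr_ge0.
pose Z i w := if r < enorm (m w) then c w * m w ord0 i else 0.
have mZ i : measurable_fun (setT : set TG) (Z i).
  apply: measurable_fun_ifT => //; first exact: measurable_fun_ltr.
  by apply: measurable_funM => //; move/measurable_fun_rowP : mm; exact.
have Z1 i w : `|Z i w| <= 1.
  rewrite /Z; case: ifP => _; last by rewrite normr0.
  have den_gt0 : 0 < 1 + enorm (m w) ^+ 2 by rewrite ltr_wpDr// sqr_ge0.
  rewrite normrM (gtr0_norm (c0 w)) ler_pdivrMl// mulr1.
  rewrite (le_trans (normr_coord_le _ _))//; set a := enorm _.
  have := sqr_ge0 (a - 1); have := sqr_ge0 a; lra.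
have IZ i : integrableR (fun w => Z i w * (X w ord0 i - m w ord0 i)).
  have Ih := integrable_sub_cond_exp (Xm i).
  apply: (ae_le_integrable _ Ih).
    apply: measurable_funM; last exact: integrable_EFin_measurable Ih.
    exact: measurable_fun_sub sG Gm _ _ _ (mZ i).
  by apply: aeW => w; rewrite normrM ler_piMl.
pose S w := \sum_(i < n) Z i w * (X w ord0 i - m w ord0 i).
have IS : integrableR S by exact: integrable_EFin_sum.
have S0 : \int[P]_w S w = 0.
  by rewrite Rintegral_sumT// big1// => i _; exact: cond_exp_pull_out (Xm i) _ _.
have SE w : S w = if r < enorm (m w)
    then c w * (dot (m w) (X w) - enorm (m w) ^+ 2) else 0.
  rewrite /S /Z; case: ifP => _; last by rewrite big1// => i _; rewrite mul0r.
  rewrite enorm_sqr -dotBr mulr_sumr; apply: eq_bigr => i _.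
  by rewrite !mxE mulrA.
(* On |m| > r, Cauchy-Schwarz gives <m, X> <= |m| |X| < |m|^2, so S is negative there and zero
   elsewhere. As S has integral 0, that event is null. *)
have Sneg : {ae P, forall w, S w <= 0 /\ (S w = 0 -> cball0 r (m w))}.
  apply: filterS Xr => w rX; rewrite SE /cball0/=.
  case: ltP => // rm; have m0 : 0 < enorm (m w).
    by rewrite (le_lt_trans _ rm)// (le_trans _ rX)// enorm_ge0.
  have : c w * (dot (m w) (X w) - enorm (m w) ^+ 2) < 0.
    rewrite pmulr_rlt0// subr_lt0 (le_lt_trans (dot_le_enorm _ _))//.
    by rewrite expr2 ltr_pM2l// (le_lt_trans rX).
  by move=> Slt0; split=> [|S0']; [exact: ltW|rewrite S0' ltxx in Slt0].
have mS : measurable_fun setT (EFin \o S) by exact: measurable_int IS.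
have : ae_eq P setT (EFin \o S) (cst 0%E).
  apply/ae_eq_integral_abs => //.
  have -> : (\int[P]_w `|(EFin \o S) w| = \int[P]_w (- S w)%:E)%E.
    apply: ae_eq_integral => //.
    - exact: measurableT_comp.
    - exact/measurable_EFinP/measurable_funN/measurable_EFinP.
    - by apply: filterS Sneg => w [Sw _] _ /=; rewrite ler0_norm.
  under eq_integral do rewrite EFinN.
  by rewrite integralN ?integrable_add_def// -EFin_RintegralT// S0 oppe0.
move=> SZ; apply: filterS2 SZ Sneg => w SZ [_]; apply.
by have := SZ I => -[].
Qed.

End conditional_moments.

Lemma loewner_le_scalar (R : realType) (n : nat) (sigma : R) (C : 'M[R]_n)
    (v : 'rV[R]_n) : loewner_le sigma%:M C ->
  sigma * enorm v ^+ 2 <= \sum_(i < n) \sum_(j < n) v ord0 i * C i j * v ord0 j.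
Proof.
move=> [_ /(_ v)]; rewrite mulmxBr mulmxBl mxE [X in _ + X]mxE subr_ge0.
rewrite mul_mx_scalar -scalemxAl mxE -dot_mulmx enorm_sqr => H.
have E (u w : 'rV[R]_n) : (u *m w^T) ord0 ord0 = dot u w.
  by rewrite mxE; apply: eq_bigr => i _; rewrite mxE.
by rewrite !E in H.
Qed.

(** * The estimate for one time and one coordinate *)

Section gradient_bound.
Context {d dA : measure_display} {T : measurableType d} {A : measurableType dA}.
Context {R : realType} {n : nat}.
Variables (P : probability T R) (G : set (set T)).
Hypotheses (sG : sigma_algebra setT G) (Gm : G `<=` measurable).

Local Notation integrableR f := (P.-integrable setT (EFin \o f)).
Local Notation TG := (g_sigma_algebraType G).

Variables (r beta gamma eps sigma : R) (F : 'rV[R]_n -> A -> R).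
Hypotheses (gamma_ge0 : 0 <= gamma) (sigma_gt0 : 0 < sigma).
Hypothesis mF : measurable_fun [set: 'rV[R]_n * A] (fun p => F p.1 p.2).
Hypothesis dF : forall z a, differentiable (fun z => F z a) z.
Hypothesis d2F : forall a j y,
  differentiable (fun z => 'D_(delta_mx ord0 j) (fun z => F z a) z) y.
Hypothesis grad_le : forall a y, cball0 r y ->
  enorm (gradient (fun z => F z a) y) <= beta.
Hypothesis hess_le : forall a y, cball0 r y ->
  spectral_norm (hessian (fun z => F z a) y) <= gamma.

Variables (x m : T -> 'rV[R]_n) (C : T -> 'M[R]_n) (a : T -> A).
Hypothesis mx : measurable_fun setT x.
Hypothesis ma : measurable_fun (setT : set TG) a.
Hypothesis x_ball : {ae P, forall w, cball0 r (x w)}.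
Hypothesis xm : is_cond_exp_rV P G x m.
Hypothesis xC : is_cond_cov P G x m C.
Hypothesis x_near : {ae P, forall w, enorm (x w - m w) <= eps}.
Hypothesis C_ge : {ae P, forall w, loewner_le sigma%:M (C w)}.
Hypothesis IF2 : integrableR (fun w => F (x w) (a w) ^+ 2).

Let h w := x w - m w.
Let Fm w := F (m w) (a w).
Let v w := gradient (fun z => F z (a w)) (m w).

Let mm : measurable_fun (setT : set TG) m.
Proof. exact: measurable_cond_exp_rV xm. Qed.

Let mFm : measurable_fun (setT : set TG) Fm.
Proof. exact: (measurableT_comp mF (measurable_fun_pair mm ma)). Qed.

Let mv : measurable_fun (setT : set TG) v.
Proof. exact: measurable_gradient. Qed.

Let mvi i : measurable_fun (setT : set TG) (fun w => v w ord0 i).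
Proof. by move/measurable_fun_rowP : mv; exact. Qed.

Let m_ball : {ae P, forall w, cball0 r (m w)}.
Proof. exact: (cond_exp_cball0 sG Gm xm x_ball). Qed.

Let v_le : {ae P, forall w, enorm (v w) <= beta}.
Proof. by apply: filterS m_ball => w; exact: grad_le. Qed.

Let vi_le i : {ae P, forall w, `|v w ord0 i| <= beta}.
Proof. by apply: filterS v_le => w; exact/le_trans/normr_coord_le. Qed.

Let near_balls : {ae P, forall w,
  [/\ cball0 r (m w), cball0 r (m w + h w) & enorm (h w) <= eps]}.
Proof.
apply: filterS3 x_ball m_ball x_near => w rx rm xe; split => //.
by rewrite addrC subrK.
Qed.

Let xE w : m w + h w = x w.
Proof. by rewrite addrC subrK. Qed.

Let taylor_F : {ae P, forall w,
  `|F (x w) (a w) - Fm w - dot (v w) (h w)| <= gamma / 2 * eps ^+ 2}.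
Proof.
apply: filterS near_balls => w [rm rx he].
have := taylor_remainder (dF^~ (a w)) (d2F (a w)) (hess_le (a w)) rm rx.
rewrite xE => /le_trans; apply.
rewrite ler_wpM2l ?divr_ge0// ler_pXn2r// nnegrE ?enorm_ge0//.
by rewrite (le_trans _ he)// enorm_ge0.
Qed.

(** Domination uses |F(m)| <= |F(x)| + beta eps together with |y| <= 1 + y^2, because only the
    square of F(x) is known to be integrable. *)
Let IFm : integrableR Fm.
Proof.
apply: (@ae_le_integrable _ _ _ _ _ (fun w => 1 + F (x w) (a w) ^+ 2 + beta * eps)).
- exact: measurable_fun_sub sG Gm _ _ _ mFm.
- apply: integrable_EFinD; last exact: integrable_EFin_cst.
  by apply: integrable_EFinD => //; exact: integrable_EFin_cst.
apply: filterS near_balls => w [rm rx he].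
have := lipschitz_ball (dF^~ (a w)) (grad_le (a w)) rm rx; rewrite xE => L.
have b0 : 0 <= beta by rewrite (le_trans (enorm_ge0 _) (grad_le (a w) rm)).
have L2 : `|F (x w) (a w) - F (m w) (a w)| <= beta * eps.
  by rewrite (le_trans L)// ler_wpM2l.
have S0 := sqr_ge0 (F (x w) (a w) - 1); have S1 := sqr_ge0 (F (x w) (a w) + 1).
rewrite [leRHS]ger0_norm; last first.
  rewrite !addr_ge0 ?sqr_ge0//.
  by rewrite mulr_ge0// (le_trans _ he)// enorm_ge0.
move: L2 S0 S1; rewrite !ler_norml /Fm.
move: (F (x w) _) (F (m w) _) => y z /andP[] *; apply/andP; split; lra.
Qed.

Let L w := dot (v w) (h w).

(** In coordinates each summand is a G-measurable weight F(m) v_j times the centered x_j - m_j. The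
    almost sure bounds |v_j| <= beta and |h_j| <= eps leave beta eps |F(m)| as dominating
    function. *)
Let cross : integrableR (fun w => Fm w * L w) /\ \int[P]_w (Fm w * L w) = 0.
Proof.
have E : (fun w => Fm w * L w) =
    (fun w => \sum_(j < n) (Fm w * v w ord0 j) * (x w ord0 j - m w ord0 j)).
  apply/funext => w; rewrite mulr_sumr; apply: eq_bigr => j _.
  by rewrite /h !mxE mulrA.
have mj j : measurable_fun (setT : set TG) (fun w => Fm w * v w ord0 j).
  exact: measurable_funM.
have Ij j : integrableR (fun w => (Fm w * v w ord0 j) * (x w ord0 j - m w ord0 j)).
  apply: (@ae_le_integrable _ _ _ _ _ (fun w => (beta * eps) * Fm w)).
  - apply: measurable_funM; first exact: measurable_fun_sub sG Gm _ _ _ (mj j).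
    exact: integrable_EFin_measurable (integrable_sub_cond_exp (xm j)).
  - exact: integrable_EFinZ.
  apply: filterS2 (vi_le j) near_balls => w vj [_ _ he].
  have hj := le_trans (normr_coord_le _ j) he.
  rewrite -mulrA !normrM mulrC ler_wpM2r//.
  have -> : x w ord0 j - m w ord0 j = h w ord0 j by rewrite /h !mxE.
  by rewrite -!normrM [leRHS]ger0_norm ?normrM ?ler_pM ?mulr_ge0//;
    [exact: le_trans vj|exact: le_trans hj].
rewrite E; split; first exact: integrable_EFin_sum.
by rewrite Rintegral_sumT// big1// => j _; exact: (cond_exp_pull_out sG Gm (xm j)).
Qed.

Let Q w := \sum_(i < n) \sum_(j < n) v w ord0 i * C w i j * v w ord0 j.

(** The difference is a sum of bounded G-measurable weights v_i v_j times h_i h_j - C_ij, which is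
    centered because C is the conditional covariance. *)
Let quad : integrableR (fun w => L w ^+ 2 - Q w) /\ \int[P]_w (L w ^+ 2 - Q w) = 0.
Proof.
have E : (fun w => L w ^+ 2 - Q w) =
    (fun w => \sum_(i < n) \sum_(j < n) (v w ord0 i * v w ord0 j) *
       (((x w - m w)^T *m (x w - m w)) i j - C w i j)).
  apply/funext => w; rewrite expr2 /L /Q {1}/dot mulr_suml -sumrB.
  apply: eq_bigr => i _; rewrite mulr_sumr -sumrB; apply: eq_bigr => j _.
  have -> : ((x w - m w)^T *m (x w - m w)) i j = h w ord0 i * h w ord0 j.
    by rewrite mxE big_ord1 mxE.
  ring.
have mij i j : measurable_fun (setT : set TG) (fun w => v w ord0 i * v w ord0 j).
  exact: measurable_funM.
have Iij i j : integrableR (fun w => (v w ord0 i * v w ord0 j) *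
       (((x w - m w)^T *m (x w - m w)) i j - C w i j)).
  have IH := integrable_sub_cond_exp (xC i j).
  apply: (ae_le_integrable _ (integrable_EFinZ (beta * beta) IH)).
    apply: measurable_funM; first exact: measurable_fun_sub sG Gm _ _ _ (mij i j).
    exact: integrable_EFin_measurable IH.
  apply: filterS2 (vi_le i) (vi_le j) => w vi vj.
  rewrite normrM [leRHS]normrM ler_wpM2r// !normrM ler_pM//.
    exact: le_trans vi (ler_norm _).
  exact: le_trans vj (ler_norm _).
rewrite E; split; first by apply: integrable_EFin_sum => i; exact: integrable_EFin_sum.
rewrite Rintegral_sumT => [|i]; last exact: integrable_EFin_sum.
rewrite big1// => i _; rewrite Rintegral_sumT// big1// => j _.
exact: (cond_exp_pull_out sG Gm (xC i j)).
Qed.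

Let IV : integrableR (fun w => enorm (v w) ^+ 2).
Proof.
apply: (@ae_bounded_integrable _ _ _ _ _ (beta ^+ 2)).
  apply: measurable_funX; apply: measurable_enorm.
  exact: measurable_fun_sub sG Gm _ _ _ mv.
apply: filterS v_le => w vb; rewrite ger0_norm ?sqr_ge0//.
by rewrite ler_pXn2r// nnegrE ?enorm_ge0// (le_trans _ vb)// enorm_ge0.
Qed.

(* With g := F (., a), expand g(x) = g(m) + L + rem and drop (g(m) + rem)^2 >= 0;
   the cross term 2 g(m) L is centered and |2 rem L| <= beta gamma eps^3. *)
Let lower : {ae P, forall w, sigma * enorm (v w) ^+ 2 <=
  F (x w) (a w) ^+ 2 + beta * gamma * eps ^+ 3
  + ((-2) * (Fm w * L w) + (-1) * (L w ^+ 2 - Q w))}.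
Proof.
apply: filterS3 taylor_F v_le (filterI near_balls C_ge) => w.
set rem := F _ _ - _ - _ => rem_le vb [[_ _ he] /loewner_le_scalar Cw].
have {}Cw := Cw (v w); rewrite -/(Q w) in Cw.
have Lb : `|L w| <= beta * eps.
  by rewrite (le_trans (normr_dot_le _ _))// ler_pM ?enorm_ge0.
have RL : `|rem * L w| <= (gamma / 2 * eps ^+ 2) * (beta * eps).
  by rewrite normrM ler_pM.
have -> : F (x w) (a w) = Fm w + L w + rem by rewrite /rem /L; ring.
have S := sqr_ge0 (Fm w + rem).
have /ler_normlP[] := RL; lra.
Qed.

Lemma Rintegral_gradient_mean_le : sigma * \int[P]_w (enorm (v w) ^+ 2) <=
  \int[P]_w (F (x w) (a w) ^+ 2) + beta * gamma * eps ^+ 3.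
Proof.
have [Ic Ec] := cross; have [Iq Eq] := quad.
have I1 := integrable_EFinD IF2 (integrable_EFin_cst P (beta * gamma * eps ^+ 3)).
have I2 := integrable_EFinD (integrable_EFinZ (-2) Ic) (integrable_EFinZ (-1) Iq).
have := ae_le_Rintegral (integrable_EFinZ sigma IV) (integrable_EFinD I1 I2) lower.
rewrite RintegralZT// RintegralDT// (RintegralDT IF2)//; last exact: integrable_EFin_cst.
rewrite Rintegral_cstT (RintegralDT (integrable_EFinZ (-2) Ic) (integrable_EFinZ (-1) Iq)).
by rewrite !RintegralZT// Ec Eq !mulr0 !addr0.
Qed.

Let U w := enorm (gradient (fun z => F z (a w)) (x w)) ^+ 2.

Lemma integrable_sqr_gradient : integrableR U.
Proof.
apply: (@ae_bounded_integrable _ _ _ _ _ (beta ^+ 2)).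
  apply: measurable_funX; apply: measurable_enorm; apply: measurable_gradient => //.
  exact: measurable_fun_sub sG Gm _ _ _ ma.
apply: filterS x_ball => w xr; have vb := grad_le (a w) xr.
rewrite ger0_norm ?sqr_ge0// ler_pXn2r// nnegrE ?enorm_ge0//.
by rewrite (le_trans _ vb)// enorm_ge0.
Qed.

Lemma Rintegral_gradient_le : \int[P]_w U w <=
  2 / sigma * (\int[P]_w (F (x w) (a w) ^+ 2) + beta * gamma * eps ^+ 3)
  + 2 * gamma ^+ 2 * eps ^+ 2.
Proof.
have le2 : {ae P, forall w, U w <= 2 * enorm (v w) ^+ 2 + 2 * gamma ^+ 2 * eps ^+ 2}.
  apply: filterS near_balls => w [rm rx he].
  have := gradient_lipschitz (d2F (a w)) gamma_ge0 (hess_le (a w)) rm rx.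
  rewrite xE => Lg; rewrite /U; set g := gradient _ (x w) in Lg *.
  have gv : enorm g <= enorm (v w) + gamma * eps.
    rewrite -[X in enorm X](subrK (v w)) addrC (le_trans (enormD _ _))// lerD2l.
    by rewrite (le_trans Lg)// ler_wpM2l.
  have g0 := enorm_ge0 g.
  (* This square turns (p + q)^2 into at most 2 p^2 + 2 q^2. *)
  have S := sqr_ge0 (enorm (v w) - gamma * eps).
  have : enorm g ^+ 2 <= (enorm (v w) + gamma * eps) ^+ 2.
    by rewrite ler_pXn2r// nnegrE// (le_trans g0).
  by move: S; rewrite sqrrB sqrrD exprMn; lra.
have I2 := integrable_EFinD (integrable_EFinZ 2 IV) (integrable_EFin_cst P (2 * gamma ^+ 2 * eps ^+ 2)).
have := ae_le_Rintegral integrable_sqr_gradient I2 le2.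
rewrite RintegralDT ?Rintegral_cstT; [|exact: integrable_EFinZ|exact: integrable_EFin_cst].
rewrite RintegralZT// => /le_trans; apply; rewrite lerD2r -mulrA ler_wpM2l//.
by rewrite ler_pdivlMl// Rintegral_gradient_mean_le.
Qed.

End gradient_bound.

(** * Measurability with respect to the history *)

Section history_measurability.
Context {d dA : measure_display} {Omega : measurableType d}.
Context {A : measurableType dA} {R : realType} {n : nat}.
Variables (x : nat -> Omega -> 'rV[R]_n) (ahat : nat -> Omega -> A).

Lemma history_measurable (p q : nat) :
  (forall s, (1 <= s <= p)%N -> measurable_fun setT (x s)) ->
  (forall s, (1 <= s <= q)%N -> measurable_fun setT (ahat s)) ->
  history x ahat p q `<=` measurable.
Proof.
move=> mx ma; apply: smallest_sub; first exact: sigma_algebra_measurable.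
move=> B [[s sp [C mC <-]]|[s sq [C mC <-]]]; first exact: mx.
exact: ma.
Qed.

(** Applied with [p = t] and [s = q = t.+1]: [filtF'] runs one step further in the predictions than
    in the inputs, so [ahat t.+1] is measurable for every G containing it. *)
Lemma preimage_history (p q s : nat) : (1 <= s <= q)%N ->
  preimage_set_system setT (ahat s) measurable `<=` history x ahat p q.
Proof. by move=> sq B HB; apply: sub_sigma_algebra; right; exists s. Qed.

End history_measurability.

(** * Summation over times and coordinates *)

Theorem theorem9
  (R : realType) (d dA : measure_display)
  (Omega : measurableType d) (A : measurableType dA) (P : probability Omega R)
  (n k T : nat) (Rx beta_e gamma_e eps sigma : R) (R0 : nat -> R)
  (f : nat -> 'rV[R]_n -> A -> 'rV[R]_k) (a_star : nat -> A)
  (e : nat -> 'rV[R]_n -> A -> 'rV[R]_k)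
  (x : nat -> Omega -> 'rV[R]_n) (ahat : nat -> Omega -> A)
  (beta_gt0 : 0 < beta_e) (gamma_gt0 : 0 < gamma_e)
  (eps_gt0 : 0 < eps) (sigma_gt0 : 0 < sigma)
  (e_def : forall (t : nat) (y : 'rV[R]_n) (a : A), (1 <= t <= T)%N ->
     e t y a = f t y (a_star t) - f t y a)
  (e_meas : forall t : nat, (1 <= t <= T)%N ->
     measurable_fun [set: 'rV[R]_n * A] (fun p => e t p.1 p.2))
  (e_diff2 : forall (t : nat) (a : A), (1 <= t <= T)%N ->
     twice_differentiable (fun y => e t y a))
  (e_grad : forall (t : nat) (i : 'I_k) (y : 'rV[R]_n) (a : A),
     (1 <= t <= T)%N -> cball0 Rx y ->
     enorm (gradient (fun z => e t z a ord0 i) y) <= beta_e)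
  (e_hess : forall (t : nat) (i : 'I_k) (y : 'rV[R]_n) (a : A),
     (1 <= t <= T)%N -> cball0 Rx y ->
     spectral_norm (hessian (fun z => e t z a ord0 i) y) <= gamma_e)
  (x_meas : forall t : nat, (1 <= t <= T)%N ->
     measurable_fun [set: Omega] (x t))
  (ahat_meas : forall t : nat, (1 <= t <= T)%N ->
     measurable_fun [set: Omega] (ahat t))
  (x_ball : forall t : nat, (1 <= t <= T)%N ->
     {ae P, forall w, cball0 Rx (x t w)})
  (eps_le : eps <= Num.min (1 / 4)
                     (Num.min (1 / (2 * gamma_e)) (1 / (4 * beta_e * gamma_e))))
  (x_cond : forall t : nat, (t < T)%N ->
     exists (G : set (set Omega)),
       [/\ sigma_algebra setT G,
           filtF' x ahat t `<=` G,
           G `<=` filtF x ahat t.+1 &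
           exists (m : Omega -> 'rV[R]_n) (C : Omega -> 'M[R]_n),
             [/\ is_cond_exp_rV P G (x t.+1) m,
                 is_cond_cov P G (x t.+1) m C,
                 {ae P, forall w, enorm (x t.+1 w - m w) <= eps} &
                 {ae P, forall w, loewner_le sigma%:M (C w)}]])
  (regret0 :
     ('E_P[fun w =>
          (\sum_(1 <= t < T.+1) enorm (e t (x t w) (ahat t w)) ^+ 2)%R]
        <= (R0 T)%:E)%E)
  (R0_le : R0 T <= eps ^+ 3 * T%:R) :
  ('E_P[fun w => (\sum_(1 <= t < T.+1)
          frobenius_norm (jacobian (fun y => e t y (ahat t w)) (x t w)) ^+ 2)%R]
     <= (2 * k%:R / sigma * (1 + gamma_e + beta_e * gamma_e) * eps ^+ 3 * T%:R
         + 2 * k%:R * gamma_e ^+ 2 * eps ^+ 2 * T%:R)%:E)%E.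
Proof.
pose F (t : nat) (i : 'I_k) (z : 'rV[R]_n) (b : A) : R := e t z b ord0 i.
pose W (t : nat) (i : 'I_k) w : R := F t i (x t w) (ahat t w) ^+ 2.
pose U (t : nat) (i : 'I_k) w : R :=
  enorm (gradient (fun z => F t i z (ahat t w)) (x t w)) ^+ 2.
(* Times 1, ..., T are reindexed as [t.+1] with [t : 'I_T], matching the conditioning at time t of
   the input [x t.+1]. *)
have bnd (t : 'I_T) : (1 <= t.+1 <= T)%N by rewrite /= ltn_ord.
have mF (t : 'I_T) i :
    measurable_fun [set: 'rV[R]_n * A] (fun p => F t.+1 i p.1 p.2).
  by move/measurable_fun_rowP : (e_meas _ (bnd t)); exact.
have mW (t : 'I_T) i : measurable_fun setT (W t.+1 i).
  apply: measurable_funX.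
  exact: (measurableT_comp (mF t i)
    (measurable_fun_pair (x_meas _ (bnd t)) (ahat_meas _ (bnd t)))).
have regretE : (fun w => \sum_(1 <= t < T.+1) enorm (e t (x t w) (ahat t w)) ^+ 2)
    = (fun w => \sum_(t < T) \sum_(i < k) W t.+1 i w).
  apply/funext => w; rewrite big_add1/= big_mkord; apply: eq_bigr => t _.
  by rewrite enorm_sqr; apply: eq_bigr => i _; rewrite /W expr2.
have frobE : (fun w => \sum_(1 <= t < T.+1)
      frobenius_norm (jacobian (fun y => e t y (ahat t w)) (x t w)) ^+ 2)
    = (fun w => \sum_(t < T) \sum_(i < k) U t.+1 i w).
  apply/funext => w; rewrite big_add1/= big_mkord; apply: eq_bigr => t _.
  rewrite frobenius_norm_jacobian//.
  by have [] := e_diff2 _ (ahat t.+1 w) (bnd t).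
rewrite regretE unlock in regret0; rewrite frobE unlock => {regretE frobE}.
pose S w := \sum_(t < T) \sum_(i < k) W t.+1 i w.
have W0 t i w : 0 <= W t i w by exact: sqr_ge0.
have S0 w : 0 <= S w by apply: sumr_ge0 => t _; apply: sumr_ge0.
(* The regret bound is a real number, so the nonnegative total loss S is integrable; it then
   dominates every single [W t.+1 i]. *)
have IS : P.-integrable setT (EFin \o S).
  apply/integrableP; split.
    apply/measurable_EFinP; apply: measurable_sum => t.
    exact: measurable_sum.
  under eq_integral => w _ do rewrite /= ger0_norm//.
  exact: le_lt_trans regret0 (ltry _).
have IW (t : 'I_T) i : P.-integrable setT (EFin \o W t.+1 i).
  apply: (ae_le_integrable _ IS) => //; apply: aeW => w; rewrite !ger0_norm//.
  rewrite /S (bigD1 t)//= (bigD1 i)//= -addrA lerDl addr_ge0 ?sumr_ge0// => t' _.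
  exact: sumr_ge0.
have step (t : 'I_T) i : P.-integrable setT (EFin \o U t.+1 i) /\
    \int[P]_w U t.+1 i w <= 2 / sigma * (\int[P]_w W t.+1 i w
        + beta_e * gamma_e * eps ^+ 3) + 2 * gamma_e ^+ 2 * eps ^+ 2.
  have [G [sG FG GF [m [C [xm xC x_near C_ge]]]]] := x_cond _ (ltn_ord t).
  have Gm : G `<=` measurable.
    apply: subset_trans GF _; apply: history_measurable => s /andP[s1 st].
      by apply: x_meas; rewrite s1 (leq_trans st).
    by apply: ahat_meas; rewrite s1 (leq_trans st).
  have ma : measurable_fun (setT : set (g_sigma_algebraType G)) (ahat t.+1).
    apply: measurable_fun_subP; apply: subset_trans FG.
    by apply: preimage_history; rewrite leqnn.
  have dF z b : differentiable (fun z => F t.+1 i z b) z.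
    by apply: differentiable_row_coord; have [] := e_diff2 _ b (bnd t).
  have d2F b j y : differentiable
      (fun z => 'D_(delta_mx ord0 j) (fun z => F t.+1 i z b) z) y.
    exact: differentiable_derive_row_coord (e_diff2 _ b (bnd t)) _.
  have grad_le b y := @e_grad t.+1 i y b (bnd t).
  have hess_le b y := @e_hess t.+1 i y b (bnd t).
  split.
    exact: (integrable_sqr_gradient sG Gm (mF t i) dF grad_le (x_meas _ (bnd t)) ma
      (x_ball _ (bnd t))).
  exact: (Rintegral_gradient_le sG Gm (ltW gamma_gt0) sigma_gt0 (mF t i) dF d2F
    grad_le hess_le (x_meas _ (bnd t)) ma (x_ball _ (bnd t)) xm xC x_near C_ge
    (IW t i)).
have IU t i := (step t i).1.
have IUt (t : 'I_T) : P.-integrable setT (EFin \o (fun w => \sum_(i < k) U t.+1 i w)).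
  exact: integrable_EFin_sum.
have IWt (t : 'I_T) : P.-integrable setT (EFin \o (fun w => \sum_(i < k) W t.+1 i w)).
  exact: integrable_EFin_sum.
have IUS : P.-integrable setT (EFin \o (fun w => \sum_(t < T) \sum_(i < k) U t.+1 i w)).
  exact: integrable_EFin_sum.
rewrite -EFin_RintegralT// lee_fin.
have {regret0} ES : \sum_(t < T) \sum_(i < k) \int[P]_w W t.+1 i w <= eps ^+ 3 * T%:R.
  rewrite -EFin_RintegralT// lee_fin in regret0.
  apply: le_trans R0_le; apply: le_trans regret0.
  rewrite (Rintegral_sumT _ IWt); apply: ler_sum => t _.
  by rewrite Rintegral_sumT.
rewrite (Rintegral_sumT _ IUt).
(* For k = 0 both sides vanish; otherwise k >= 1 lets the regret term be multiplied by k below. *)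
have [k0|k_gt0] := posnP k.
  rewrite big1 => [|t _]; first by rewrite k0 !(mulr0, mul0r) addr0.
  rewrite Rintegral_sumT// big1// => i _.
  by have := ltn_ord i; rewrite [X in (_ < X)%N]k0.
have k1 : 1 <= k%:R :> R by rewrite ler1n.
(* The regret already sums over coordinates, so its bound enters once, whereas the error terms enter
   k T times. *)
apply: (@le_trans _ _ (2 / sigma * (eps ^+ 3 * T%:R)
  + k%:R * T%:R * (2 / sigma * (beta_e * gamma_e * eps ^+ 3)
                   + 2 * gamma_e ^+ 2 * eps ^+ 2))).
  apply: (@le_trans _ _ (\sum_(t < T) \sum_(i < k)
    (2 / sigma * \int[P]_w W t.+1 i w + (2 / sigma * (beta_e * gamma_e * eps ^+ 3)
                   + 2 * gamma_e ^+ 2 * eps ^+ 2)))).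
    apply: ler_sum => t _; rewrite Rintegral_sumT//; apply: ler_sum => i _.
    by rewrite addrA -mulrDr; exact: (step t i).2.
  under eq_bigr do rewrite big_split/= -mulr_sumr sumr_const card_ord.
  rewrite big_split/= -mulr_sumr sumr_const card_ord lerD//.
    by rewrite ler_wpM2l// divr_ge0// ltW.
  by rewrite -mulrnA -[leLHS]mulr_natl natrM.
(* With X = (2 / sigma) eps^3 T, the target exceeds the intermediate bound by exactly (k - 1) X + k
   gamma X, the two quantities shown nonnegative in [k2] and [g0]. *)
have s0 : 0 <= 2 / sigma * (eps ^+ 3 * T%:R).
  by rewrite !mulr_ge0 ?invr_ge0 ?exprn_ge0 ?ler0n// ltW.
have g0 : 0 <= k%:R * gamma_e * (2 / sigma * (eps ^+ 3 * T%:R)).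
  by rewrite !mulr_ge0 ?invr_ge0 ?exprn_ge0 ?ler0n// ltW.
have k2 : 0 <= (k%:R - 1) * (2 / sigma * (eps ^+ 3 * T%:R)).
  by rewrite mulr_ge0// subr_ge0.
lra.
Qed.
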